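(* Let $(A, d_1, \ldots, d_N)$ be an AssHDer pair of rank $N$ and let $(M, d_1^M, \ldots, d_N^M)$ be a representation of it. Then $(A \oplus M, d_1 \oplus d_1^M, \ldots, d_N \oplus d_N^M)$ is an AssHDer pair, where the associative algebra structure on $A \oplus M$ is given by the semi-direct product $(a,m)(b,n) = (ab, an + mb)$.
   Context: All vector spaces and linear maps are over a field $\mathbb{K}$ of characteristic zero. Algebras are associative, not assumed unital. $N\ge 1$ is an integer. A higher derivation of rank $N$ on an associative algebra $A$ is a sequence $\{d_1, \ldots, d_N\}$ of linear maps $A \to A$ with $d_k(ab) = \sum_{i+j=k} d_i(a) d_j(b)$ for $1 \le k \le N$, $a,b\in A$, where $i,j\ge 0$ and $d_0 = \mathrm{id}_A$. An AssHDer pair of rank $N$ is a tuple $(A, d_1, \ldots, d_N)$ of an associative algebra and a higher derivation of rank $N$ on it. A representation of $(A, d_1, \ldots, d_N)$ is a tuple $(M, d_1^M, \ldots, d_N^M)$ where $M$ is an $A$-bimodule and $d_k^M : M \to M$ are linear with $d_k^M(am) = \sum_{i+j=k} d_i(a) d_j^M(m)$ and $d_k^M(ma) = \sum_{i+j=k} d_i^M(m) d_j(a)$ for $1\le k \le N$, $a \in A$, $m\in M$ (with $d_0 = \mathrm{id}_A$, $d_0^M = \mathrm{id}_M$). *)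

(* Defs.v *)
From mathcomp Require Import all_boot all_order all_algebra.

Set Implicit Arguments.
Unset Strict Implicit.
Unset Printing Implicit Defensive.

Import GRing.Theory.
Local Open Scope ring_scope.

(* MathComp's ring and algebra structures are unital, so a not necessarily
   unital associative algebra is a K-module with an explicit product. *)
Definition bilinear_map (K : fieldType) (U V W : lmodType K)
    (f : U -> V -> W) : Prop :=
  (forall v, linear (f^~ v)) /\ (forall u, linear (f u)).

Definition assoc_algebra (K : fieldType) (A : lmodType K)
    (mul : A -> A -> A) : Prop :=
  bilinear_map mul /\ associative mul.

Record bimodule (K : fieldType) (A : lmodType K) (mul : A -> A -> A)
    (M : lmodType K) (lact : A -> M -> M) (ract : M -> A -> M) : Prop :=
  Bimodule {
    lact_bilinear : bilinear_map lact;
    ract_bilinear : bilinear_map ract;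
    lact_mul : forall a b m, lact (mul a b) m = lact a (lact b m);
    ract_mul : forall m a b, ract m (mul a b) = ract (ract m a) b;
    lact_ract : forall a m b, ract (lact a m) b = lact a (ract m b)
  }.

(* A sequence d_1, ..., d_N is a family d indexed by 'I_N, where d k stands for
   d_(k+1); with_id d is the sequence d_0 = id, d_1, ..., d_N. *)
Definition with_id (N : nat) (T : Type) (d : 'I_N -> T -> T)
    (i : 'I_N.+1) : T -> T :=
  if unlift ord0 i is Some k then d k else id.

Definition higher_derivation (K : fieldType) (A : lmodType K)
    (mul : A -> A -> A) (N : nat) (d : 'I_N -> A -> A) : Prop :=
  (forall k, linear (d k)) /\
  (forall (k : 'I_N) (a b : A),
     d k (mul a b) =
     \sum_(i < N.+1) \sum_(j < N.+1 | (i + j == k.+1)%N)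
        mul (with_id d i a) (with_id d j b)).

Definition AssHDer_pair (K : fieldType) (A : lmodType K)
    (mul : A -> A -> A) (N : nat) (d : 'I_N -> A -> A) : Prop :=
  assoc_algebra mul /\ higher_derivation mul d.

Record AssHDer_representation (K : fieldType) (A : lmodType K)
    (mul : A -> A -> A) (N : nat) (d : 'I_N -> A -> A)
    (M : lmodType K) (lact : A -> M -> M) (ract : M -> A -> M)
    (dM : 'I_N -> M -> M) : Prop :=
  AssHDerRepresentation {
    rep_bimodule : bimodule mul lact ract;
    rep_linear : forall k, linear (dM k);
    rep_lact : forall (k : 'I_N) (a : A) (m : M),
      dM k (lact a m) =
      \sum_(i < N.+1) \sum_(j < N.+1 | (i + j == k.+1)%N)
         lact (with_id d i a) (with_id dM j m);
    rep_ract : forall (k : 'I_N) (m : M) (a : A),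
      dM k (ract m a) =
      \sum_(i < N.+1) \sum_(j < N.+1 | (i + j == k.+1)%N)
         ract (with_id dM i m) (with_id d j a)
  }.

Definition semidirect_mul (K : fieldType) (A M : lmodType K)
    (mul : A -> A -> A) (lact : A -> M -> M) (ract : M -> A -> M)
    (x y : A * M) : A * M :=
  (mul x.1 y.1, lact x.1 y.2 + ract x.2 y.1).

Definition map_dsum (A M : Type) (f : A -> A) (g : M -> M) (x : A * M) : A * M :=
  (f x.1, g x.2).

(* Main.v *)
Require Import Defs.
From mathcomp Require Import all_boot all_order all_algebra.

Import GRing.Theory.
Local Open Scope ring_scope.

(** Everything is checked on the two components of [A * M]. The [A]-component of each identity is
    the corresponding axiom of [A]. The [M]-component of a product is the sum of a left and a right
    action, so its associativity comes from the three bimodule axioms, and its Leibniz rule is the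
    sum of the rules for [lact] and [ract], which run over the same index pairs. *)

Lemma linear_add (K : fieldType) (U V : lmodType K) (f : U -> V) (u v : U) :
  linear f -> f (u + v) = f u + f v.
Proof. by move=> lin_f; have := lin_f 1 u v; rewrite !scale1r. Qed.

(** At index 0 this holds because the identity of [A * M] is the direct sum of the two identities.
    It lets the Leibniz sums on [A * M] split into components, terms with [i = 0] or [j = 0]
    included. *)
Lemma with_id_map_dsum (N : nat) (A M : Type)
    (d : 'I_N -> A -> A) (dM : 'I_N -> M -> M) (i : 'I_N.+1) (x : A * M) :
  with_id (fun k => map_dsum (d k) (dM k)) i x =
  (with_id d i x.1, with_id dM i x.2).
Proof. by rewrite /with_id; case: unlift => [k|] //; case: x. Qed.

Lemma semidirect_assoc_algebra (K : fieldType) (A M : lmodType K)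
    (mul : A -> A -> A) (lact : A -> M -> M) (ract : M -> A -> M) :
  assoc_algebra mul -> bimodule mul lact ract ->
  @assoc_algebra K (A * M)%type (semidirect_mul mul lact ract).
Proof.
move=> [[mul_l mul_r] mulA] [[lact_l lact_r] [ract_l ract_r] lactM ractM lractA].
split; first split.
- move=> [b n] c [a m] [a' m']; congr pair => /=; first exact: mul_l.
  by rewrite lact_l ract_l scalerDr addrACA.
- move=> [b n] c [a m] [a' m']; congr pair => /=; first exact: mul_r.
  by rewrite lact_r ract_r scalerDr addrACA.
- move=> [a m] [b n] [c p]; rewrite /semidirect_mul /= mulA; congr pair.
  (* Once expanded, each side has three terms, with the module element in first, middle or last
     position; each position is matched by one bimodule axiom. *)
  rewrite (linear_add _ _ _ _ _ _ (lact_r a)) (linear_add _ _ _ _ _ _ (ract_l c)).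
  by rewrite lactM ractM lractA addrA.
Qed.

Lemma map_dsum_linear (K : fieldType) (A M : lmodType K)
    (f : A -> A) (g : M -> M) :
  linear f -> linear g -> linear (map_dsum f g : (A * M)%type -> (A * M)%type).
Proof.
by move=> lin_f lin_g c [a m] [b n]; congr pair; [exact: lin_f | exact: lin_g].
Qed.

Lemma semidirect_higher_derivation (K : fieldType) (N : nat)
    (A : lmodType K) (mul : A -> A -> A) (d : 'I_N -> A -> A)
    (M : lmodType K) (lact : A -> M -> M) (ract : M -> A -> M)
    (dM : 'I_N -> M -> M) :
  higher_derivation mul d -> AssHDer_representation mul d lact ract dM ->
  @higher_derivation K (A * M)%type (semidirect_mul mul lact ract) N
    (fun k : 'I_N => map_dsum (d k) (dM k)).
Proof.
move=> [lin_d d_mul] [_ lin_dM dM_lact dM_ract].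
split=> [k | k [a m] [b n]]; first exact: map_dsum_linear.
rewrite [LHS]surjective_pairing [RHS]surjective_pairing; congr pair.
(* The projections are additive, so they pass through both nested sums. *)
- rewrite raddf_sum /= d_mul; apply: eq_bigr => i _.
  by rewrite raddf_sum /=; apply: eq_bigr => j _; rewrite !with_id_map_dsum.
(* Additivity of [dM k] separates [lact a n] from [ract m b]; the two resulting double sums are then
   merged term by term. *)
- rewrite raddf_sum /= (linear_add _ _ _ _ _ _ (lin_dM k)) dM_lact dM_ract.
  rewrite -big_split; apply: eq_bigr => i _ /=.
  rewrite raddf_sum -big_split; apply: eq_bigr => j _ /=.
  by rewrite !with_id_map_dsum.
Qed.

Theorem proposition3p2 (K : fieldType) (char0 : [pchar K] =i pred0)
    (N : nat) (N_gt0 : (0 < N)%N)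
    (A : lmodType K) (mul : A -> A -> A) (d : 'I_N -> A -> A)
    (HA : AssHDer_pair mul d)
    (M : lmodType K) (lact : A -> M -> M) (ract : M -> A -> M)
    (dM : 'I_N -> M -> M)
    (HM : AssHDer_representation mul d lact ract dM) :
  @AssHDer_pair K (A * M)%type (semidirect_mul mul lact ract) N
    (fun k : 'I_N => map_dsum (d k) (dM k)).
Proof.
case: HA => algA derA; split.
- exact: semidirect_assoc_algebra algA (rep_bimodule HM).
- exact: semidirect_higher_derivation derA HM.
Qed.
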